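(* Let $H$ be a Hilbert space and $X$ any Banach space. Let $f:X\to H$ be an $\varepsilon$-nearisometry with $f(0)=0$. Then there is a continuous linear operator $T:H\to X$ with $\|T\|=1$ such that $$\|Tf(x)-x\|\le 2\varepsilon\quad\text{for all }x\in X.$$
   Context: All Banach and Hilbert spaces are real. For $\varepsilon\ge 0$, a map $f:X\to Y$ between Banach spaces (not assumed continuous or surjective) is an $\varepsilon$-nearisometry if $|\,\|f(x)-f(y)\|-\|x-y\|\,|\le\varepsilon$ for all $x,y\in X$. *)

(* Defs.v *)
From HB Require Import structures.
From mathcomp Require Import all_boot all_order all_algebra.
From mathcomp Require Import sesquilinear.
From mathcomp Require Import all_classical all_reals all_analysis.

Set Implicit Arguments.
Unset Strict Implicit.
Unset Printing Implicit Defensive.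

Import Order.TTheory GRing.Theory Num.Theory.
Import numFieldNormedType.Exports.

Local Open Scope classical_set_scope.
Local Open Scope ring_scope.

(* With theta := idfun, {dot H for theta} is the type of symmetric positive
   definite bilinear forms on H. *)
HB.mixin Record CompleteNormedModule_isHilbert (R : realType) H
    of CompleteNormedModule R H := {
  inner : {dot H for (@idfun R)} ;
  inner_normE : forall x : H, inner x x = `|x| ^+ 2
}.

#[short(type="hilbertType")]
HB.structure Definition Hilbert (R : realType) :=
  {H of CompleteNormedModule R H & CompleteNormedModule_isHilbert R H}.

Definition nearisometry (R : realType) (X Y : completeNormedModType R)
    (eps : R) (f : X -> Y) : Prop :=
  forall x y : X, `| `|f x - f y| - `|x - y| | <= eps.

(* This is the operator norm when T is bounded; the real-valued sup is 0 on
   unbounded sets. *)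
Definition opnorm (R : realType) (V W : normedModType R) (T : V -> W) : R :=
  sup [set `|T v| | v in [set v : V | `|v| <= 1]].

(* Main.v *)
(* By the parallelogram identity, |f(sx)/s - f(tx)/t|^2 = O(1/s + 1/t), so
   U x := lim f(nx)/n exists.  U is an isometry into a strictly convex space,
   hence linear; T is U^-1 composed with the orthogonal projection onto the
   complete subspace U(X).  Expanding |f x - f(nw)| <= |x - nw| + eps and
   dividing by n gives <U x - f x, U w> <= 2 eps |w|, and the choice
   w := x - T(f x) turns the left-hand side into |w|^2. *)
From HB Require Import structures.
Require Import Defs.
From mathcomp Require Import all_boot all_order all_algebra.
From mathcomp Require Import sesquilinear ring lra.
From mathcomp Require Import all_classical all_reals all_analysis.

Set Implicit Arguments.
Unset Strict Implicit.
Unset Printing Implicit Defensive.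

Import Order.TTheory GRing.Theory Num.Theory.
Import numFieldNormedType.Exports.

Local Open Scope classical_set_scope.
Local Open Scope ring_scope.

(** * Inner product identities and two convergence lemmas *)

Lemma innerC (R : realType) (H : hilbertType R) (x y : H) :
  inner x y = inner y x.
Proof. by rewrite hermC /= expr0 mul1r. Qed.

Lemma innerZr (R : realType) (H : hilbertType R) (a : R) (x y : H) :
  inner x (a *: y) = a * inner x y.
Proof. by rewrite linearZr. Qed.

Lemma innerZl (R : realType) (H : hilbertType R) (a : R) (x y : H) :
  inner (a *: x) y = a * inner x y.
Proof. by rewrite linearZl. Qed.

Lemma sqr_normB (R : realType) (H : hilbertType R) (x y : H) :
  `|x - y| ^+ 2 = `|x| ^+ 2 - 2 * inner x y + `|y| ^+ 2.
Proof.
rewrite -!inner_normE linearBl !linearBr/= (innerC y x); ring.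
Qed.

Lemma sqr_normD (R : realType) (H : hilbertType R) (x y : H) :
  `|x + y| ^+ 2 = `|x| ^+ 2 + 2 * inner x y + `|y| ^+ 2.
Proof.
rewrite -!inner_normE linearDl !linearDr/= (innerC y x); ring.
Qed.

Lemma sqr_normZ (R : realType) (V : normedModType R) (a : R) (x : V) :
  `|a *: x| ^+ 2 = a ^+ 2 * `|x| ^+ 2.
Proof. by rewrite normrZ exprMn real_normK ?num_real. Qed.

Lemma cvg_innerr (R : realType) (H : hilbertType R) (u : nat -> H) (l a : H) :
  u @ \oo --> l -> inner a (u n) @[n --> \oo] --> inner a l.
Proof.
move=> ul.
(* Polarization reduces continuity of the inner product to continuity of the norm. *)
have polar y : inner a y = 2^-1 * (`|a| ^+ 2 + `|y| ^+ 2 - `|a - y| ^+ 2).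
  by rewrite sqr_normB; field.
rewrite polar; under eq_fun do rewrite polar.
apply: cvgM; first exact: cvg_cst.
apply: cvgB.
  apply: cvgD; first exact: cvg_cst.
  by rewrite expr2; under eq_fun do rewrite expr2; apply: cvgM; apply: cvg_norm.
rewrite expr2; under eq_fun do rewrite expr2.
by apply: cvgM; apply: cvg_norm; apply: cvgB => //; exact: cvg_cst.
Qed.

(** A Cauchy criterion in the form that expanding squared norms yields; it serves both the rescaled
    images under [f] and the minimizing sequence for the projection. *)
Lemma cvg_sqr_dist_harmonic (R : realType) (V : completeNormedModType R)
    (u : nat -> V) (C : R) :
  (forall n m, `|u n - u m| ^+ 2 <= C * (n.+1%:R^-1 + m.+1%:R^-1)) ->
  cvg (u @ \oo).
Proof.
move=> uC; apply/cauchy_cvgP/cauchy_exP => e e0.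
have h0 : C * harmonic n @[n --> \oo] --> C * (0 : R).
  by apply: cvgM; [exact: cvg_cst|exact: cvg_harmonic].
rewrite mulr0 in h0.
have e20 : 0 < e ^+ 2 / 2 by rewrite divr_gt0 // exprn_gt0.
move/cvgr0Pnorm_lt: h0 => /(_ _ e20)[N _ NP].
exists (u N), N => // n /= Nn.
rewrite -ball_normE/= -ltr_sqr ?nnegrE ?(ltW e0) //.
apply: (le_lt_trans (uC _ _)).
have := NP _ (leqnn N); have := NP n Nn.
rewrite /= /harmonic !ltr_norml => /andP[_ a] /andP[_ b].
by rewrite mulrDr [e ^+ 2]splitr ltrD.
Qed.

(** * The asymptotic isometry and its linearity *)

(** With [r] the norm of [x], the leading terms of the expanded square cancel as
    [r^2 - 2 r^2 + r^2]. In the factor 6, the two squared norms contribute 2 (one on [1/s], the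
    other on [1/t]) and the cross term contributes 4 on both. *)
Lemma nearisometry_scaled_sqr_dist (R : realType) (H : hilbertType R)
    (X : completeNormedModType R) (eps : R) (eps_ge0 : 0 <= eps) (f : X -> H)
    (f_near : nearisometry eps f) (f0 : f 0 = 0) (x : X) (s t : R) :
  1 <= s -> 1 <= t ->
  `|s^-1 *: f (s *: x) - t^-1 *: f (t *: x)| ^+ 2 <=
    (6 * `|x| * eps + 2 * eps ^+ 2) * (s^-1 + t^-1).
Proof.
move=> s1 t1.
have s0 : 0 < s by lra.
have t0 : 0 < t by lra.
have fnorm k : 0 < k ->
    `|f (k *: x)| <= k * `|x| + eps /\ k * `|x| - eps <= `|f (k *: x)|.
  move=> k0; have := f_near (k *: x) 0.
  by rewrite f0 !subr0 normrZ (gtr0_norm k0) ler_norml => /andP[? ?]; split; lra.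
have [Au Al] := fnorm _ s0; have [Bu Bl] := fnorm _ t0.
have Du : `|f (s *: x) - f (t *: x)| <= `|s - t| * `|x| + eps.
  have := f_near (s *: x) (t *: x).
  by rewrite -scalerBl normrZ ler_norml => /andP[? ?]; lra.
rewrite sqr_normB innerZl innerZr !sqr_normZ.
have := sqr_normB (f (s *: x)) (f (t *: x)).
move: Au Al Bu Bl Du; have := normr_ge0 (f (s *: x) - f (t *: x)).
have := normr_ge0 (f (t *: x)); have := normr_ge0 (f (s *: x)).
have := normr_ge0 x.
move: (inner _ _) `|f (s *: x)| `|f (t *: x)| `|_ - _| `|x| =>
  I A B D r r0 A0 B0 D0 Au Al Bu Bl Du DE.
have sp : s * s^-1 = 1 by rewrite divff ?gt_eqF.
have tq : t * t^-1 = 1 by rewrite divff ?gt_eqF.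
have p0 : 0 < s^-1 by rewrite invr_gt0.
have q0 : 0 < t^-1 by rewrite invr_gt0.
have p1 : s^-1 <= 1 by rewrite invf_le1.
have q1 : t^-1 <= 1 by rewrite invf_le1.
move: (s^-1) (t^-1) sp tq p0 q0 p1 q1 => p q sp tq p0 q0 p1 q1.
(* Here [w] is the inverse of [k]; [w <= 1] weakens the term [eps^2 w^2] to first order in [w]. *)
have upper k K w : k * w = 1 -> 0 < w -> w <= 1 -> 0 <= K ->
    K <= k * r + eps ->
    w ^+ 2 * K ^+ 2 <= r ^+ 2 + 2 * r * eps * w + eps ^+ 2 * w.
  move=> kw w0 w1 K0 Ku.
  have Kw : K * w <= r + eps * w.
    have -> : r + eps * w = (k * r + eps) * w by rewrite mulrDl mulrAC kw mul1r.
    by rewrite ler_pM2r.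
  have Kw2 : (K * w) ^+ 2 <= (r + eps * w) ^+ 2.
    have Kw0 : 0 <= K * w by rewrite mulr_ge0 // ltW.
    by rewrite lerXn2r // nnegrE // (le_trans Kw0).
  have e2w : eps ^+ 2 * w ^+ 2 <= eps ^+ 2 * w.
    by rewrite ler_wpM2l ?sqr_ge0 // expr2 ler_piMl // ltW.
  rewrite mulrC -exprMn; apply: (le_trans Kw2); move: e2w; lra.
have lower k K : 0 < k -> 0 <= K -> k * r - eps <= K ->
    k ^+ 2 * r ^+ 2 - 2 * eps * (k * r) <= K ^+ 2.
  move=> k0 K0 Kl; have kr0 : 0 <= k * r by rewrite mulr_ge0 // ltW.
  (* Squaring [k r - eps <= K] requires a nonnegative left side; when [k r <= eps] the claimed lower
     bound is itself nonpositive. *)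
  by have [?|?] := leP (k * r) eps; nra.
have Aup := upper _ _ _ sp p0 p1 A0 Au.
have Bup := upper _ _ _ tq q0 q1 B0 Bu.
have pq0 : 0 < p * q by rewrite mulr_gt0.
have Alo := lower _ _ s0 A0 Al.
have Blo := lower _ _ t0 B0 Bl.
have Dup : D ^+ 2 <= (s - t) ^+ 2 * r ^+ 2 + 2 * eps * r * (s + t) + eps ^+ 2.
  have stD : `|s - t| <= s + t by rewrite ler_norml; apply/andP; split; lra.
  have Dsq : D ^+ 2 <= (`|s - t| * r + eps) ^+ 2.
    by rewrite lerXn2r // nnegrE // addr_ge0 // mulr_ge0.
  apply: (le_trans Dsq).
  rewrite sqrrD exprMn real_normK ?num_real // lerD2r lerD2l.
  have : `|s - t| * (r * eps) <= (s + t) * (r * eps).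
    by rewrite ler_wpM2r // mulr_ge0.
  by move=> ?; rewrite mulr2n; lra.
(* By [DE], [- 2 * I] equals [D^2 - A^2 - B^2]: the upper bound on [D] combines with the lower
   bounds on [A] and [B]. *)
have mid : - 2 * I <= - 2 * s * t * r ^+ 2 + 4 * eps * r * (s + t) + eps ^+ 2.
  by lra.
have midpq : (- 2 * I) * (p * q) <=
    (- 2 * s * t * r ^+ 2 + 4 * eps * r * (s + t) + eps ^+ 2) * (p * q).
  by rewrite ler_pM2r.
have mid_eq :
    (- 2 * s * t * r ^+ 2 + 4 * eps * r * (s + t) + eps ^+ 2) * (p * q) =
    - 2 * r ^+ 2 + 4 * eps * r * (p + q) + eps ^+ 2 * (p * q).
  have -> : - 2 * r ^+ 2 + 4 * eps * r * (p + q) + eps ^+ 2 * (p * q) =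
    - 2 * (s * p) * (t * q) * r ^+ 2 +
    4 * eps * r * ((t * q) * p + (s * p) * q) + eps ^+ 2 * (p * q).
    by rewrite sp tq; ring.
  by ring.
have e2pq : eps ^+ 2 * (p * q) <= eps ^+ 2 * p.
  by rewrite ler_wpM2l ?sqr_ge0 // ler_piMr // ltW.
have e2q : 0 <= eps ^+ 2 * q by rewrite mulr_ge0 ?sqr_ge0 ?ltW.
by rewrite mid_eq in midpq; lra.
Qed.

Lemma nearisometry_asymptote (R : realType) (H : hilbertType R)
    (X : completeNormedModType R) (eps : R) (eps_ge0 : 0 <= eps) (f : X -> H)
    (f_near : nearisometry eps f) (f0 : f 0 = 0) :
  exists U : X -> H,
    forall x, n.+1%:R^-1 *: f (n.+1%:R *: x) @[n --> \oo] --> U x.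
Proof.
exists (fun x => lim (n.+1%:R^-1 *: f (n.+1%:R *: x) @[n --> \oo])) => x.
apply: (@cvg_sqr_dist_harmonic _ _ _ (6 * `|x| * eps + 2 * eps ^+ 2)) => n m.
by apply: (nearisometry_scaled_sqr_dist eps_ge0 f_near f0); rewrite ler1n.
Qed.

(** Dilation by [n.+1] stretches distances in [X] but leaves the error at [eps], so rescaling
    shrinks the error to [eps / n.+1]. *)
Lemma asymptote_isometry (R : realType) (X Y : completeNormedModType R)
    (eps : R) (f : X -> Y) (f_near : nearisometry eps f) (U : X -> Y) :
  (forall x, n.+1%:R^-1 *: f (n.+1%:R *: x) @[n --> \oo] --> U x) ->
  forall x y, `|U x - U y| = `|x - y|.
Proof.
move=> fU x y.
have cU : `|n.+1%:R^-1 *: f (n.+1%:R *: x) - n.+1%:R^-1 *: f (n.+1%:R *: y)|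
    @[n --> \oo] --> `|U x - U y|.
  by apply: cvg_norm; apply: cvgB.
have bound (c : R) : `|x - y| + c * harmonic n @[n --> \oo] --> `|x - y|.
  rewrite -[X in _ --> X]addr0 -(mulr0 c).
  apply: cvgD; first exact: cvg_cst.
  by apply: cvgM; [exact: cvg_cst|exact: cvg_harmonic].
have near_dist n : let d := `|n.+1%:R^-1 *: f (n.+1%:R *: x)
      - n.+1%:R^-1 *: f (n.+1%:R *: y)| in
    `|x - y| - eps * harmonic n <= d <= `|x - y| + eps * harmonic n.
  have n0 : 0 < n.+1%:R^-1 :> R by rewrite invr_gt0 ltr0n.
  have -> : `|x - y| = n.+1%:R^-1 * `|n.+1%:R *: x - n.+1%:R *: y|.
    by rewrite -scalerBr normrZ normr_nat mulKf ?pnatr_eq0.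
  rewrite /= /harmonic -(scalerBr _ (f _)) (normrZ _ (f _ - f _)) (gtr0_norm n0).
  have := f_near (n.+1%:R *: x) (n.+1%:R *: y).
  rewrite ler_norml => /andP[? ?].
  rewrite (mulrC eps) -mulrBr -mulrDr !ler_pM2l //; apply/andP; split; lra.
apply/eqP; rewrite eq_le; apply/andP; split.
- apply: (ler_cvg_to cU (bound eps)); apply: nearW => n.
  by case/andP: (near_dist n).
- apply: (ler_cvg_to (bound (- eps)) cU); apply: nearW => n.
  by rewrite mulNr; case/andP: (near_dist n).
Qed.

(** Inner products are expanded in [H] only. Homogeneity holds because the norms of [x], [a *: x]
    and [a *: x - x], known in any normed space, fix the norm of [U (a *: x) - a *: U x]. *)
Lemma isometry_linear (R : realType) (H : hilbertType R)
    (X : completeNormedModType R) (U : X -> H) :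
  (forall x y, `|U x - U y| = `|x - y|) -> U 0 = 0 -> linear U.
Proof.
move=> Uiso U0.
have Unorm x : `|U x| = `|x| by have := Uiso x 0; rewrite U0 !subr0.
have UZ a x : U (a *: x) = a *: U x.
  apply/eqP; rewrite -subr_eq0 -normr_eq0 -sqrf_eq0; apply/eqP.
  have ax : `|a *: x - x| ^+ 2 = (a - 1) ^+ 2 * `|x| ^+ 2.
    by rewrite -sqr_normZ scalerBl scale1r.
  have := sqr_normB (U (a *: x)) (U x).
  rewrite Uiso ax sqr_normB innerZr sqr_normZ !Unorm sqr_normZ => E; nra.
have UD x y : U (x + y) = U x + U y.
  (* Homogeneity reduces additivity to preservation of the midpoint [z]. As [U z] is at distance
     [|x - y| / 2] from both [U x] and [U y], the parallelogram identity forces it to be their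
     midpoint. *)
  have U2 : U (x + y) = 2 *: U (2^-1 *: (x + y)).
    by rewrite UZ scalerA divff ?scale1r.
  have half (v : X) : v = 2^-1 *: (v + v).
    by rewrite -mulr2n -(scaler_nat 2 v) scalerA mulVf ?scale1r.
  set z := 2^-1 *: (x + y) in U2.
  have zx : `|U z - U x| ^+ 2 = 2^-1 ^+ 2 * `|x - y| ^+ 2.
    rewrite Uiso -sqr_normZ distrC; congr (`|_| ^+ 2).
    by rewrite {1}(half x) -(scalerBr _ (x + x)) opprD addrACA subrr add0r.
  have zy : `|U z - U y| ^+ 2 = 2^-1 ^+ 2 * `|x - y| ^+ 2.
    rewrite Uiso -sqr_normZ; congr (`|_| ^+ 2).
    by rewrite {1}(half y) -(scalerBr _ (x + y)) opprD addrACA subrr addr0.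
  apply/eqP; rewrite -subr_eq0 U2 -normr_eq0 -sqrf_eq0; apply/eqP.
  have := sqr_normB (U z - U x) (U z - U y).
  have -> : U z - U x - (U z - U y) = - (U x - U y).
    by rewrite !opprB addrC subrKA.
  have := sqr_normD (U z - U x) (U z - U y).
  have -> : U z - U x + (U z - U y) = 2 *: U z - (U x + U y).
    by rewrite addrACA -opprD scaler_nat mulr2n.
  by rewrite normrN (Uiso x y) zx zy => E F; lra.
by move=> a x y; rewrite UD UZ.
Qed.

(** * Orthogonal projection onto the range of a linear isometry *)

(** The difference [U x - U y] is orthogonal to the range of [U], hence to itself. This later yields
    both linearity of [T] and [T (U x) = x]. *)
Lemma projection_unique (R : realType) (H : hilbertType R)
    (X : completeNormedModType R) (U : {linear X -> H}) :
  (forall x, `|U x| = `|x|) -> forall h x y,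
  (forall w, inner (h - U x) (U w) = 0) ->
  (forall w, inner (h - U y) (U w) = 0) -> x = y.
Proof.
move=> Unorm h x y hx hy; apply/eqP.
rewrite -subr_eq0 -normr_eq0 -Unorm -sqrf_eq0 -inner_normE {1}linearB.
have -> : U x - U y = (h - U y) - (h - U x) by rewrite opprB [RHS]addrC subrKA.
by rewrite linearBl /= hx hy subrr.
Qed.

(** The distance is minimized over [X] rather than over the range: since [U] preserves norms,
    completeness of [X] gives the limit of a minimizing sequence directly. *)
Lemma projection_exists (R : realType) (H : hilbertType R)
    (X : completeNormedModType R) (U : {linear X -> H}) :
  (forall x, `|U x| = `|x|) -> forall h,
  exists x, forall w, inner (h - U x) (U w) = 0.
Proof.
move=> Unorm h.
pose E := [set `|h - U x| ^+ 2 | x in [set: X]].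
have Einf : has_inf E.
  split; first by exists (`|h - U 0| ^+ 2), 0.
  by exists 0 => _ [x _ <-]; rewrite sqr_ge0.
have Emin x : inf E <= `|h - U x| ^+ 2.
  by apply: ge_inf; [exact: Einf.2|exists x].
have minimizing n : exists x, `|h - U x| ^+ 2 < inf E + n.+1%:R^-1.
  have n0 : 0 < n.+1%:R^-1 :> R by rewrite invr_gt0 ltr0n.
  by have [_ [x _ <-] ?] := inf_adherent n0 Einf; exists x.
have [u uE] := choice minimizing.
have /cvg_ex[x ux] : cvg (u @ \oo).
  (* By the parallelogram identity the squared distance is at most
     [2 (inf E + p) + 2 (inf E + q) - 4 inf E], the last term coming from the midpoint. *)
  apply: (@cvg_sqr_dist_harmonic _ _ _ 2) => n m.
  have mid : 2 *: h - U (u n + u m) = 2 *: (h - U (2^-1 *: (u n + u m))).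
    by rewrite linearZ scalerBr scalerA divff ?scale1r.
  have := Emin (2^-1 *: (u n + u m)).
  have := congr1 (fun v => `|v| ^+ 2) mid; rewrite /= sqr_normZ.
  have -> : 2 *: h - U (u n + u m) = (h - U (u n)) + (h - U (u m)).
    by rewrite linearD scaler_nat mulr2n opprD addrACA.
  have := sqr_normB (h - U (u n)) (h - U (u m)).
  have -> : h - U (u n) - (h - U (u m)) = - U (u n - u m).
    by rewrite (linearB U) !opprB addrC subrKA.
  rewrite normrN Unorm (sqr_normD (h - U _)); have := uE n; have := uE m.
  move: (n.+1%:R^-1) (m.+1%:R^-1) => p q ? ? ? ? ?; lra.
have Uu : `|h - U (u n)| ^+ 2 @[n --> \oo] --> `|h - U x| ^+ 2.
  rewrite expr2; under eq_fun do rewrite expr2.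
  have Ux : U (u n) @[n --> \oo] --> U x.
    apply/cvgrPdist_lt => e e0; near=> n.
    rewrite -linearB Unorm; near: n.
    by move/cvgrPdist_lt: ux; apply.
  by apply: cvgM; apply: cvg_norm; apply: cvgB => //; exact: cvg_cst.
have xmin : `|h - U x| ^+ 2 <= inf E.
  have inf_cvg : inf E + harmonic n @[n --> \oo] --> inf E.
    rewrite -[X in _ --> X]addr0.
    by apply: cvgD; [exact: cvg_cst|exact: cvg_harmonic].
  by apply: (ler_cvg_to Uu inf_cvg); apply: nearW => n; apply: ltW; exact: uE.
exists x => w; set i := inner _ _.
(* The minimum over [t] of [|h - U x - t U w|^2] lies at [t = 0]; any positive
   step along the gradient smaller than [2 i / |w|^2] would go lower. *)
pose k := `|U w| ^+ 2; have k0 : 0 <= k by rewrite sqr_ge0.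
pose t := i / (k + 1).
have ti : i = t * (k + 1) by rewrite /t divfK // gt_eqF //; lra.
have := Emin (x + t *: w).
rewrite linearD linearZ /= opprD addrA sqr_normB innerZr sqr_normZ -/i -/k => xt.
have t2 : t ^+ 2 * (k + 2) <= 0 by move: xmin xt; rewrite ti => ? ?; nra.
have t0 : t ^+ 2 <= 0 by move: (sqr_ge0 t); nra.
have /eqP : t ^+ 2 = 0 by apply/eqP; rewrite eq_le t0 sqr_ge0.
by rewrite sqrf_eq0 ti => /eqP ->; rewrite mul0r.
Unshelve. all: by end_near. Qed.

(** * The inner product estimate and the operator [T] *)

Lemma nearisometry_inner_le (R : realType) (H : hilbertType R)
    (X : completeNormedModType R) (eps : R) (eps_ge0 : 0 <= eps) (f : X -> H)
    (f_near : nearisometry eps f) (f0 : f 0 = 0) (U : {linear X -> H}) :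
  (forall x, `|U x| = `|x|) ->
  (forall x, n.+1%:R^-1 *: f (n.+1%:R *: x) @[n --> \oo] --> U x) ->
  forall x w, inner (U x) (U w) - inner (f x) (U w) <= 2 * eps * `|w|.
Proof.
move=> Unorm fU x w.
(* [C] collects the terms that stay bounded in [t]. Of the [2 eps |w|], one half comes from the
   lower bound on [|f (t *: w)|], the other from the error in [|f x - f (t *: w)|]. *)
pose C := `|x| ^+ 2 + 2 * eps * `|x| + eps ^+ 2.
have step n : inner (U x) (U w) - 2 * eps * `|w| - C * harmonic n <=
    inner (f x) (n.+1%:R^-1 *: f (n.+1%:R *: w)).
  rewrite innerZr /harmonic /=.
  have t0 : 0 < n.+1%:R :> R by rewrite ltr0n.
  move: (n.+1%:R : R) t0 => t t0.
  (* [X] carries no inner product, so the square is expanded in [H] through [U]. *)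
  have xtw : `|x - t *: w| ^+ 2 =
      `|x| ^+ 2 - 2 * (t * inner (U x) (U w)) + t ^+ 2 * `|w| ^+ 2.
    by rewrite -Unorm linearB linearZ /= sqr_normB innerZr sqr_normZ !Unorm.
  have v_ge : t * `|w| - eps <= `|f (t *: w)|.
    have := f_near (t *: w) 0.
    by rewrite f0 !subr0 normrZ (gtr0_norm t0) ler_norml => /andP[? ?]; lra.
  have v2_ge : t ^+ 2 * `|w| ^+ 2 - 2 * eps * (t * `|w|) <= `|f (t *: w)| ^+ 2.
    have tw0 : 0 <= t * `|w| by rewrite mulr_ge0 // ltW.
    have := normr_ge0 (f (t *: w)).
    by have [?|?] := leP (t * `|w|) eps; nra.
  have d_le : `|f x - f (t *: w)| <= `|x - t *: w| + eps.
    by have := f_near x (t *: w); rewrite ler_norml => /andP[? ?]; lra.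
  have d2_le : `|f x - f (t *: w)| ^+ 2 <= (`|x - t *: w| + eps) ^+ 2.
    by rewrite lerXn2r // nnegrE // addr_ge0.
  have xtw_le : `|x - t *: w| * eps <= eps * `|x| + eps * (t * `|w|).
    rewrite mulrC -mulrDr ler_wpM2l //; apply: (le_trans (ler_normB _ _)).
    by rewrite normrZ gtr0_norm.
  have fx0 := sqr_ge0 `|f x|.
  rewrite -(ler_pM2l t0) mulVKf ?gt_eqF // !mulrBr.
  rewrite (mulrC C) mulVKf ?gt_eqF //.
  have C0 : 0 <= C by rewrite /C !addr_ge0 ?mulr_ge0 ?sqr_ge0.
  move: d2_le; rewrite sqr_normB sqrrD xtw => d2_le.
  by rewrite /C in C0 *; lra.
have lhs : inner (U x) (U w) - 2 * eps * `|w| - C * harmonic n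
    @[n --> \oo] --> inner (U x) (U w) - 2 * eps * `|w|.
  rewrite -[X in _ --> X]subr0 -[X in _ --> _ - X](mulr0 C).
  apply: cvgB; first exact: cvg_cst.
  by apply: cvgM; [exact: cvg_cst|exact: cvg_harmonic].
rewrite lerBlDl -lerBlDr.
exact: (ler_cvg_to lhs (cvg_innerr (a := f x) (fU w)) (nearW _ step)).
Qed.

Theorem theorem2p6 (R : realType) (H : hilbertType R)
    (X : completeNormedModType R) (X_neq0 : exists x : X, x != 0)
    (eps : R) (eps_ge0 : 0 <= eps) (f : X -> H)
    (f_near : nearisometry eps f) (f0 : f 0 = 0) :
  exists T : {linear H -> X},
    [/\ continuous T,
        opnorm T = 1 &
        forall x : X, `|T (f x) - x| <= 2 * eps].
Proof.
have [U0 fU0] := nearisometry_asymptote eps_ge0 f_near f0.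
have Uiso := asymptote_isometry f_near fU0.
have U00 : U0 0 = 0.
  have := fU0 0; under eq_fun do rewrite scaler0 f0 scaler0.
  by move=> h; apply: (cvg_unique (@norm_hausdorff _ H) h); exact: cvg_cst.
pose U : {linear X -> H} :=
  HB.pack U0 (GRing.isLinear.Build _ _ _ _ _ (isometry_linear Uiso U00)).
have Unorm x : `|U x| = `|x| by have := Uiso x 0; rewrite U00 !subr0.
have [T0 T0P] := choice (projection_exists Unorm).
(* The combination of the chosen preimages satisfies the orthogonality that determines the value at
   [a *: g + h]. *)
have T0lin : linear T0.
  move=> a g h; apply: (projection_unique Unorm (T0P _)) => w.
  rewrite linearD linearZ opprD addrACA -scalerBr linearDl /= innerZl.
  by rewrite !T0P mulr0 addr0.
pose T : {linear H -> X} :=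
  HB.pack T0 (GRing.isLinear.Build _ _ _ _ _ T0lin).
have TU x : T (U x) = x.
  by apply: (projection_unique Unorm (T0P _)) => w; rewrite subrr linear0l.
have Tle h : `|T h| <= `|h|.
  rewrite -ler_sqr ?nnegrE //.
  (* Pythagoras: the cross term vanishes by [T0P]. *)
  have := sqr_normD (h - U (T h)) (U (T h)); rewrite subrK T0P Unorm.
  by have := sqr_ge0 `|h - U (T h)|; lra.
exists T; split.
- move=> h; apply/cvgrPdist_lt => e e0; near=> g.
  rewrite -linearB; apply: le_lt_trans (Tle _) _; near: g.
  exact: cvgr_dist_lt.
(* A nonzero [x] gives a unit vector whose image under [U] attains the norm 1; for [X = 0] every [T]
   would have norm 0. *)
- have [x x0] := X_neq0.
  have ub : ubound [set `|T v| | v in [set v : H | `|v| <= 1]] 1.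
    by move=> _ [v /= v1 <-]; exact: le_trans v1.
  have nx : 0 < `|x| by rewrite normr_gt0.
  have one : [set `|T v| | v in [set v : H | `|v| <= 1]] 1.
    have z1 : `|(`|x|^-1 *: x)| = 1.
      by rewrite normrZ gtr0_norm ?invr_gt0 // mulVf // gt_eqF.
    by exists (U (`|x|^-1 *: x)); rewrite ?TU // /mkset Unorm z1.
  apply/eqP; rewrite eq_le; apply/andP; split.
    by apply: ge_sup => //; exists 1.
  by apply: ub_le_sup => //; exists 1.
- move=> x; set w := x - T (f x).
  rewrite distrC -/w.
  have := nearisometry_inner_le eps_ge0 f_near f0 Unorm fU0 x w.
  rewrite -linearBl /=.
  (* The second summand is orthogonal to [U w], so pairing with [U w] leaves [|w|^2]; dividing by
     [|w|] requires treating [w = 0] apart. *)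
  have -> : U x - f x = U w - (f x - U (T (f x))).
    by rewrite /w linearB opprB addrA subrK.
  rewrite linearBl /= T0P subr0 inner_normE Unorm expr2.
  have [->|w0] := eqVneq w 0; first by rewrite normr0 mulr_ge0.
  by rewrite ler_pM2r // normr_gt0.
Unshelve. all: by end_near. Qed.
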